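(* Let $(R,\mathfrak m)$ be a regular local ring of dimension $2$ and $I$ an ideal of $R$. Assume that $R/I$ is a non-Gorenstein artinian almost Gorenstein ring. Then $I$ is a Burch ideal of $R$.
   Context: An ideal $I$ of a local ring $(R,\mathfrak m)$ is a Burch ideal if $\mathfrak m I\neq\mathfrak m(I:_R\mathfrak m)$. An artinian local ring $(A,\mathfrak m_A)$ is called almost Gorenstein if $(0:_A(0:_AJ))\subseteq(J:_A\mathfrak m_A)$ for all ideals $J$ of $A$. *)

(* Defs.v *)
From HB Require Import structures.
From mathcomp Require Import all_boot all_order all_algebra ring_quotient.
From mathcomp Require Import boolp classical_sets.

Set Implicit Arguments.
Unset Strict Implicit.
Unset Printing Implicit Defensive.

Import GRing.Theory.

Local Open Scope classical_set_scope.
Local Open Scope ring_scope.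

Section Ideals.
Variable A : comNzRingType.
Implicit Types (I J M P m : set A) (s : seq A).

(* Unlike MathComp's [idealr A], this includes the unit ideal. *)
Definition is_ideal J :=
  [/\ J 0, forall x y, J x -> J y -> J (x + y) & forall a x, J x -> J (a * x)].

Definition ideal_span s : set A :=
  [set x | exists c : nat -> A, x = \sum_(i < size s) c i * s`_i].

Definition ideal_mul I J : set A :=
  [set x | exists s : seq (A * A),
     (forall p, p \in s -> I p.1 /\ J p.2) /\ x = \sum_(p <- s) p.1 * p.2].

Definition ideal_colon I J : set A := [set a | forall b, J b -> I (a * b)].

Definition prime_ideal P :=
  [/\ is_ideal P, ~ P 1 & forall x y, P (x * y) -> P x \/ P y].

Definition maximal_ideal M :=
  [/\ is_ideal M, ~ M 1
    & forall J, is_ideal J -> M `<=` J -> J = M \/ J = setT].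

Definition local_ring m :=
  maximal_ideal m /\ forall M, maximal_ideal M -> M = m.

Definition prime_chain (n : nat) :=
  exists P : nat -> set A,
    (forall i, (i <= n)%N -> prime_ideal (P i)) /\
    (forall i, (i < n)%N -> P i `<` P i.+1).

Definition krull_dim_eq (d : nat) :=
  prime_chain d /\ forall n, prime_chain n -> (n <= d)%N.

End Ideals.

Definition noetherian_ring (A : comNzRingType) :=
  forall J : set A, is_ideal J -> exists s : seq A, J = ideal_span s.

Definition artinian_ring (A : comNzRingType) :=
  forall J : nat -> set A,
    (forall n, is_ideal (J n)) -> (forall n, J n.+1 `<=` J n) ->
    exists n, forall k, (n <= k)%N -> J k = J n.

Definition regular_local_ring (A : comNzRingType) (m : set A) (d : nat) :=
  [/\ noetherian_ring A, local_ring m, krull_dim_eq A d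
    & exists s : seq A, size s = d /\ m = ideal_span s].

Definition injective_module (A : comNzRingType) (E : lmodType A) :=
  forall (M N : lmodType A) (f : {linear M -> N}) (g : {linear M -> E}),
    injective f -> exists h : {linear N -> E}, forall x, h (f x) = g x.

(* There is an exact sequence 0 -> M -> E 0 -> ... -> E n -> 0 with every E i
   injective. *)
Definition finite_injective_dimension (A : comNzRingType) (M : lmodType A) :=
  exists (n : nat) (E : nat -> lmodType A) (eps : {linear M -> E 0%N})
         (d : forall i, {linear E i -> E i.+1}),
    [/\ forall i, injective_module (E i),
        injective eps,
        forall x, d 0%N x = 0 <-> exists y, x = eps y,
        forall i x, d i.+1 x = 0 <-> exists y, x = d i y
      & forall i, (n < i)%N -> forall x : E i, x = 0].

(* This is meant for noetherian local rings (for a general noetherian ring one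
   requires it of all localizations). *)
Definition gorenstein_ring (A : comNzRingType) :=
  finite_injective_dimension (A^o : lmodType A).

Definition almost_gorenstein_ring (A : comNzRingType) :=
  artinian_ring A /\
  exists m : set A, local_ring m /\
    forall J : set A, is_ideal J ->
      ideal_colon [set 0] (ideal_colon [set 0] J) `<=` ideal_colon J m.

Definition burch_ideal (R : comNzRingType) (m I : set R) :=
  is_ideal I /\ ideal_mul m I <> ideal_mul m (ideal_colon I m).

(* Main.v *)
From HB Require Import structures.
Require Import Defs.
From mathcomp Require Import all_boot all_order all_algebra ring_quotient ring.
From mathcomp Require Import boolp classical_sets.

(** Write [A = R / I], let [x, y] be a regular system of parameters and suppose
    that [m I = m (I : m)]. If [u] is in [I : m], then [y u] is in [m I], so
    [y u = x a + y b] with [a, b] in [I]; as [x, y] is a regular sequence, this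
    shows that every socle element of [A] has the form [u = x d] with
    [y d = 0]. If [u = x d] and [v = x e] are two such elements, then [d] and
    [e] have the same annihilator, so [e] lies in [0 : (0 : d)] and the almost
    Gorenstein condition gives [v = x e] in [(d)], which forces [v] in [(u)].
    Hence the socle of [A] is simple. Counting lengths, every ideal of [A] is
    then its own double annihilator, so [A] satisfies Baer's criterion and is
    self-injective, that is, Gorenstein.

    Regularity of [x, y] comes from Krull's principal ideal theorem: given
    primes [P0 < P1 < m], no power of [y] lies in [(x) + P0], and since every
    element outside [(x)] is a unit times a power of [y] modulo [x], this gives
    [P0 <= (x)], hence [P0 = x P0 = 0]. *)

Set Implicit Arguments.
Unset Strict Implicit.
Unset Printing Implicit Defensive.

Import GRing.Theory.

Local Open Scope classical_set_scope.
Local Open Scope ring_scope.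

(** * Ideals, chain conditions, noetherian local rings *)

Section Ideals.
Variable A : comNzRingType.
Implicit Types (J K L : set A) (a b : A).

Lemma ideal0 J : is_ideal J -> J 0. Proof. by case. Qed.

Lemma idealD J a b : is_ideal J -> J a -> J b -> J (a + b).
Proof. by case=> _ + _; apply. Qed.

Lemma idealMl J a b : is_ideal J -> J b -> J (a * b).
Proof. by case=> _ _; apply. Qed.

Lemma idealMr J a b : is_ideal J -> J b -> J (b * a).
Proof. by move=> idJ Jb; rewrite mulrC; exact: idealMl. Qed.

Lemma idealN J a : is_ideal J -> J a -> J (- a).
Proof. by move=> idJ Ja; rewrite -mulN1r; exact: idealMl. Qed.

Lemma idealB J a b : is_ideal J -> J a -> J b -> J (a - b).
Proof. by move=> idJ Ja Jb; apply: idealD => //; exact: idealN. Qed.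

Lemma ideal_subr J a b : is_ideal J -> J b -> J (a - b) -> J a.
Proof. by move=> idJ Jb Jab; rewrite -(subrK b a); exact: idealD. Qed.

Lemma ideal_sum J n (F : 'I_n -> A) :
  is_ideal J -> (forall i, J (F i)) -> J (\sum_(i < n) F i).
Proof.
move=> idJ JF; elim/big_ind: _ => //; first exact: ideal0.
by move=> a b; exact: idealD.
Qed.

Lemma is_ideal_set0 : is_ideal [set 0 : A].
Proof.
split=> [//|a b -> ->|a b ->]; first by rewrite /= addr0.
by rewrite /= mulr0.
Qed.

Lemma is_idealT : is_ideal (@setT A). Proof. by []. Qed.

Lemma is_ideal_colon J K : is_ideal J -> is_ideal (ideal_colon J K).
Proof.
move=> idJ; split=> [b _|a b Ja Jb c Kc|a b Jb c Kc].
- by rewrite mul0r; exact: ideal0.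
- by rewrite mulrDl; apply: idealD; [|exact: Ja|exact: Jb].
- by rewrite -mulrA; apply: idealMl => //; exact: Jb.
Qed.

Definition adjoin J a : set A := [set z | exists j r, J j /\ z = j + r * a].

Lemma is_ideal_adjoin J a : is_ideal J -> is_ideal (adjoin J a).
Proof.
move=> idJ; split=> [|_ _ [i [r [Ji ->]]] [j [s [Jj ->]]]|c _ [j [r [Jj ->]]]].
- by exists 0, 0; split; [exact: ideal0|ring].
- by exists (i + j), (r + s); split; [exact: idealD|ring].
- by exists (c * j), (c * r); split; [exact: idealMl|ring].
Qed.

Lemma sub_adjoin J a : J `<=` adjoin J a.
Proof. by move=> j Jj; exists j, 0; split=> //; ring. Qed.

Lemma mem_adjoin J a : is_ideal J -> adjoin J a a.
Proof. by move=> idJ; exists 0, 1; split; [exact: ideal0|ring]. Qed.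

Lemma adjoin_sub J K a : is_ideal K -> J `<=` K -> K a -> adjoin J a `<=` K.
Proof.
by move=> idK JK Ka _ [j [r [/JK Kj ->]]]; apply: idealD => //; exact: idealMl.
Qed.

Lemma proper_adjoin J a : is_ideal J -> ~ J a -> J `<` adjoin J a.
Proof.
move=> idJ nJa; split; first exact: sub_adjoin.
by move=> /(_ _ (mem_adjoin a idJ)).
Qed.

Lemma prime_idealX P a n : prime_ideal P -> P (a ^+ n) -> P a.
Proof.
move=> [_ P1 PM]; elim: n => [//|n IHn].
by rewrite exprS => /PM[].
Qed.

End Ideals.

(** * Chain conditions as induction principles *)

Section ChainConditions.

(** A counterexample to [P] would always have a smaller one, and choice would string these into an
    infinite descending chain. *)
Lemma no_chain_ind (T : Type) (D : T -> Prop) (lt : T -> T -> Prop) :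
  (forall f : nat -> T, (forall n, D (f n)) -> ~ forall n, lt (f n.+1) (f n)) ->
  forall P : T -> Prop,
    (forall t, D t -> (forall s, D s -> lt s t -> P s) -> P t) ->
  forall t, D t -> P t.
Proof.
move=> nochain P IH t Dt; apply: contrapT => nPt.
pose B := {s | D s /\ ~ P s}.
have next (s : B) : exists s' : B, lt (sval s') (sval s).
  case: s => s [Ds nPs] /=; apply: contrapT => nex; apply: nPs.
  apply: IH => // s' Ds' lts; apply: contrapT => nPs'.
  by apply: nex; exists (exist _ s' (conj Ds' nPs')).
have [f ltf] := choice next.
pose g n := iter n f (exist _ t (conj Dt nPt) : B).
apply: (nochain (fun n => sval (g n))) => n; last exact: ltf.
by case: (g n) => s [].
Qed.

Variable A : comNzRingType.
Implicit Types J K : set A.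

Lemma noetherian_chain (J : nat -> set A) :
  noetherian_ring A -> (forall n, is_ideal (J n)) ->
  (forall n, J n `<=` J n.+1) -> exists n, J n.+1 `<=` J n.
Proof.
move=> noeth idJ Jmono.
have Jle i k : (i <= k)%N -> J i `<=` J k.
  move=> /subnK <-; elim: (k - i)%N => [//|d IHd].
  by apply: subset_trans IHd _; rewrite addSn.
have idU : is_ideal [set a | exists n, J n a].
  split=> [|a b [i Ja] [k Jb]|a b [i Jb]].
  - by exists 0%N; exact: ideal0.
  - exists (maxn i k); apply: idealD => //.
      by apply: Jle Ja; exact: leq_maxl.
    by apply: Jle Jb; exact: leq_maxr.
  - by exists i; exact: idealMl.
have [s defU] := noeth _ idU.
have sJ (i : 'I_(size s)) : exists n, J n s`_i.
  have: ideal_span s s`_i; last by rewrite -defU.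
  exists (fun j => (j == i :> nat)%:R).
  rewrite (bigD1 i) //= eqxx mul1r big1 ?addr0 //.
  by move=> j /negbTE; rewrite -val_eqE /= => ->; rewrite mul0r.
have [f Jf] := choice sJ.
exists (\max_i f i) => a Ja.
have: ideal_span s a by rewrite -defU; eexists; exact: Ja.
move=> [c ->]; apply: ideal_sum => // i; apply: idealMl => //.
by apply: Jle (Jf i); exact: leq_bigmax.
Qed.

Lemma noetherian_ind (P : set A -> Prop) :
  noetherian_ring A ->
  (forall J, is_ideal J -> (forall K, is_ideal K -> J `<` K -> P K) -> P J) ->
  forall J, is_ideal J -> P J.
Proof.
move=> noeth; apply: (no_chain_ind (lt := fun K J => J `<` K)) => f idf ltf.
have [|n fn] := noetherian_chain noeth idf; first by move=> n; case: (ltf n).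
by case: (ltf n).
Qed.

Lemma artinian_ind (P : set A -> Prop) :
  artinian_ring A ->
  (forall J, is_ideal J -> (forall K, is_ideal K -> K `<` J -> P K) -> P J) ->
  forall J, is_ideal J -> P J.
Proof.
move=> art; apply: (no_chain_ind (lt := fun K J => K `<` J)) => f idf ltf.
have [|n fn] := art _ idf; first by move=> n; case: (ltf n).
by case: (ltf n) => _; apply; rewrite (fn n.+1).
Qed.

End ChainConditions.

(** * Noetherian local rings *)

Section LocalRing.
Variables (A : comNzRingType) (m : set A).
Hypotheses (noeth : noetherian_ring A) (locA : local_ring m).
Implicit Types (J K L : set A) (a b : A).

Lemma local_ideal : is_ideal m. Proof. by case: locA => -[]. Qed.
Lemma local_neq1 : ~ m 1. Proof. by case: locA => -[]. Qed.

(** Noetherian induction: a proper ideal that is not maximal lies in a strictly larger proper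
    one. *)
Lemma proper_sub_local J : is_ideal J -> ~ J 1 -> J `<=` m.
Proof.
move: J; apply: (noetherian_ind noeth) => J idJ IH nJ1.
case: (EM (maximal_ideal J)) => [maxJ|nmax].
  by case: locA => _ /(_ _ maxJ) ->.
have [K [idK JK nJK nK1]] :
    exists K, [/\ is_ideal K, J `<=` K, K <> J & ~ K 1].
  apply: contrapT => nex; apply: nmax; split=> // K idK JK.
  case: (EM (K = J)) => [|nKJ]; [by left|right].
  apply: contrapT => nKT; apply: nex; exists K; split=> // K1; apply: nKT.
  by rewrite predeqE => a; split=> // _; rewrite -(mulr1 a); exact: idealMl.
apply: subset_trans (JK) _; apply: IH => //; split=> // KJ.
by apply: nJK; rewrite eqEsubset.
Qed.

Lemma local_unit a : ~ m a -> exists b, a * b = 1.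
Proof.
move=> nma; apply: contrapT => nex; apply: nma.
have id0 := is_ideal_set0 A.
apply: (@proper_sub_local (adjoin [set 0] a)); last exact: mem_adjoin.
  exact: is_ideal_adjoin.
move=> [j [r [-> e]]]; apply: nex; exists r.
by rewrite [1]e; ring.
Qed.

Lemma local_unit1B a : m a -> exists b, (1 - a) * b = 1.
Proof.
move=> ma; apply: local_unit => m1a; apply: local_neq1.
by rewrite -(subrK a 1); apply: idealD => //; exact: local_ideal.
Qed.

Lemma local_cancel L a b : is_ideal L -> m a -> L ((1 - a) * b) -> L b.
Proof.
move=> idL /local_unit1B[c e] /(idealMl c idL).
by rewrite mulrA (mulrC c) e mul1r.
Qed.

(* If [a = y ^+ n * c n] modulo [L] for all [n], then [c n] is a combination of
   [c 0, ..., c n.-1] modulo [L] for some [n]; multiplying by [y ^+ n] gives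
   [a = y * t * a]. *)
Lemma krull_intersection L y a : is_ideal L -> m y ->
  (forall n, exists c, L (a - y ^+ n * c)) -> L a.
Proof.
move=> idL my /choice[c Lc].
pose J n := [set z | exists r : nat -> A, L (z - \sum_(i < n) r i * c i)].
have idJ n : is_ideal (J n).
  split=> [|z z' [r Lr] [r' Lr']|b z [r Lr]].
  - exists (fun=> 0); rewrite big1 ?subr0; first exact: ideal0.
    by move=> i _; rewrite mul0r.
  - exists (fun i => r i + r' i).
    under eq_bigr do rewrite mulrDl.
    by rewrite big_split opprD addrACA; exact: idealD.
  - exists (fun i => b * r i).
    under eq_bigr do rewrite -mulrA.
    by rewrite -mulr_sumr -mulrBr; exact: idealMl.
have Jmono n : J n `<=` J n.+1.
  move=> z [r Lr]; exists (fun i => if i == n then 0 else r i).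
  rewrite big_ord_recr /= eqxx mul0r addr0.
  under eq_bigr => i _ do rewrite (ltn_eqF (ltn_ord i)).
  exact: Lr.
have [n] := noetherian_chain noeth idJ Jmono.
have Jcn : J n.+1 (c n).
  exists (fun i => (i == n)%:R).
  rewrite big_ord_recr /= eqxx mul1r big1 ?add0r ?subrr; first exact: ideal0.
  by move=> i _; rewrite (ltn_eqF (ltn_ord i)) mul0r.
move=> /(_ _ Jcn)[r Lr].
(* Modulo [L], [y ^+ n * c i] equals [y ^+ (n - i) * a]; as [i < n], a factor [y] comes out of each
   term. *)
apply: (@local_cancel L (y * \sum_(i < n) r i * y ^+ (n - i.+1))) => //.
  by apply: idealMr => //; exact: local_ideal.
have -> : (1 - y * \sum_(i < n) r i * y ^+ (n - i.+1)) * a =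
    (a - y ^+ n * c n) + y ^+ n * (c n - \sum_(i < n) r i * c i)
    - \sum_(i < n) r i * y ^+ (n - i) * (a - y ^+ i * c i).
  have -> : \sum_(i < n) r i * y ^+ (n - i) * (a - y ^+ i * c i) =
      y * (\sum_(i < n) r i * y ^+ (n - i.+1)) * a
      - y ^+ n * \sum_(i < n) r i * c i.
    rewrite !(mulr_sumr, mulr_suml) -sumrB; apply: eq_bigr => i _.
    have -> : y ^+ n = y ^+ (n - i) * y ^+ i by rewrite -exprD subnK // ltnW.
    rewrite -[(n - i)%N]subnSK // exprS.
    move: (y ^+ i) (y ^+ (n - i.+1)) => u v; ring.
  by move: (\sum_(i < n) _) (y ^+ n) => t u; ring.
apply: idealB => //; first by apply: idealD => //; exact: idealMl.
by apply: ideal_sum => // i; exact: idealMl.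
Qed.

End LocalRing.

(** * Two-dimensional regular local rings *)

Section TwoGenerators.
Variables (R : comNzRingType) (m : set R) (x y : R).
Hypotheses (noeth : noetherian_ring R) (locR : local_ring m).
Hypothesis m_xy : m = [set z | exists a b, z = a * x + b * y].
Implicit Types (P : set R) (a b z : R).

Let mx : m x.
Proof. by rewrite m_xy; exists 1, 0; ring. Qed.

Let my : m y.
Proof. by rewrite m_xy; exists 0, 1; ring. Qed.

(** Modulo [x] the maximal ideal is [(y)]: as long as the cofactor of [y ^+ k] is not a unit,
    another [y] can be extracted. *)
Lemma residue_power_form a k :
  (exists c r, a = y ^+ k * c + x * r) \/
  exists j u v r, [/\ (j < k)%N, u * v = 1 & a = y ^+ j * u + x * r].
Proof.
elim: k => [|k IHk]; first by left; exists a, 0; rewrite expr0; ring.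
case: IHk => [[c [r ->]]|[j [u [v [r [ltjk uv ->]]]]]]; last first.
  by right; exists j, u, v, r; split=> //; exact: ltnW.
case: (EM (m c)) => [|/(local_unit noeth locR)[v cv]]; last first.
  by right; exists k, c, v, r; split.
rewrite m_xy => -[s [t ->]]; left; exists t, (r + y ^+ k * s).
by rewrite exprS; ring.
Qed.

(** Otherwise [a] would lie in [(x) + (y ^+ k)] for every [k], hence in [(x)] by Krull's
    intersection theorem. *)
Lemma residue_unit_power a : ~ (exists r, a = x * r) ->
  exists j u v r, u * v = 1 /\ a = y ^+ j * u + x * r.
Proof.
move=> nxa; apply: contrapT => nex; apply: nxa.
suff [_ [r [-> ->]]] : adjoin [set 0] x a by exists r; ring.
apply: (krull_intersection noeth locR (y := y)) => //.
  exact/is_ideal_adjoin/is_ideal_set0.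
move=> k; have [[c [r ->]]|[j [u [v [r [_ uv ea]]]]]] := residue_power_form a k.
  by exists c, 0, r; split=> //; ring.
by case: nex; exists j, u, v, r.
Qed.

Lemma stationary_card (T : finType) (D : nat -> {set T}) :
  (forall n, D n.+1 \subset D n) -> exists n, D n.+1 = D n.
Proof.
move=> Dmono; apply: contrapT => nex.
have: forall n, (#|D n| + n <= #|D 0|)%N.
  elim=> [|n IHn]; first by rewrite addn0.
  apply: leq_trans IHn; rewrite addnS -addSn leq_add2r.
  apply: proper_card; rewrite finset.properEneq Dmono andbT.
  by apply/eqP => eD; apply: nex; exists n.
by move=> /(_ #|D 0|.+1); rewrite addnS ltnNge leq_addl.
Qed.

(** * Consequences of a chain of primes below [m] *)

Section Chain.
Variables P0 P1 : set R.
Hypotheses (prP0 : prime_ideal P0) (prP1 : prime_ideal P1).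
Hypotheses (P01 : P0 `<` P1) (P1m : P1 <> m).

Let id0 : is_ideal P0. Proof. by case: prP0. Qed.
Let id1 : is_ideal P1. Proof. by case: prP1. Qed.

Let P1_xy : P1 x -> P1 y -> False.
Proof.
move=> P1x P1y; apply: P1m; rewrite eqEsubset; split.
  by apply: (proper_sub_local noeth locR) => //; case: prP1.
by rewrite m_xy => _ [a [b ->]]; apply: idealD => //; exact: idealMl.
Qed.

(* Krull's principal ideal theorem for [R / P0]: if [m] were minimal over
   [P0 + (x)], the chain [(z ^+ n : x ^+ oo)] with [z] in [P1] but not in [P0]
   would be stationary modulo [x], hence stationary. *)
Lemma power_notin_principal N r p : P0 p -> y ^+ N = x * r + p -> False.
Proof.
move=> P0p eyN.
have nP1x : ~ P1 x.
  move=> P1x; apply: P1_xy => //; apply: (prime_idealX prP1 (n := N)).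
  by rewrite eyN; apply: idealD => //; [exact: idealMr|case: P01 => /(_ _ P0p)].
have [z P1z nP0z] : exists2 z, P1 z & ~ P0 z.
  apply: contrapT => nex; case: P01 => _; apply=> z P1z.
  by apply: contrapT => nP0z; apply: nex; exists z.
pose J n := [set a | exists k t, P0 (x ^+ k * a - z ^+ n * t)].
have idJ n : is_ideal (J n).
  split=> [|a b [k [t P0a]] [l [s P0b]]|b a [k [t P0a]]].
  - by exists 0%N, 0; rewrite !mulr0 subrr; exact: ideal0.
  - exists (k + l)%N, (x ^+ l * t + x ^+ k * s).
    have -> : x ^+ (k + l) * (a + b) - z ^+ n * (x ^+ l * t + x ^+ k * s) =
        x ^+ l * (x ^+ k * a - z ^+ n * t) + x ^+ k * (x ^+ l * b - z ^+ n * s).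
      by rewrite exprD; ring.
    by apply: idealD => //; exact: idealMl.
  - exists k, (b * t).
    have -> : x ^+ k * (b * a) - z ^+ n * (b * t) =
        b * (x ^+ k * a - z ^+ n * t) by ring.
    exact: idealMl.
have Jmono n : J n.+1 `<=` J n.
  by move=> a [k [t P0a]]; exists k, (z * t); rewrite mulrA -exprSr.
have P0J n : P0 `<=` J n.
  by move=> a P0a; exists 0%N, 0; rewrite mulr0 subr0; exact: idealMl.
(* Modulo [x] and [P0], [y ^+ N] vanishes and every nonzero element is a unit times a power of [y],
   so the exponents in [D n] determine the image of [J n]. *)
pose D n := [set i : 'I_N |
    `[< exists2 a, J n a & exists s, y ^+ i = a + x * s >]]%SET.
have [n eD] : exists n, D n.+1 = D n.
  apply: stationary_card => n; apply/fintype.subsetP => i.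
  by rewrite !inE => -[a Ja ya]; exists a => //; exact: Jmono.
have Jstep a : J n a -> exists2 c, J n c & J n.+1 (a - x * c).
  move=> Jna.
  suff [b [c [Jb ea]]] : exists b c, J n.+1 b /\ a = b + x * c.
    exists c; last by rewrite ea addrK.
    (* [J n] is saturated: [c] is in [J n] as soon as [x * c] is. *)
    have [k [t P0xc]] : J n (x * c).
      by rewrite -(addKr b (x * c)) -ea addrC; apply: idealB => //; exact: Jmono.
    by exists k.+1, t; rewrite exprSr -mulrA.
  have [[c [s ->]]|[j [u [v [s [ltjN uv ea]]]]]] := residue_power_form a N.
    exists (p * c), (r * c + s); split; last by rewrite eyN; ring.
    by apply: idealMr => //; exact: P0J.
  have: Ordinal ltjN \in D n.
    rewrite !inE; exists (v * a); first exact: idealMl.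
    exists (- (v * s)) => /=.
    rewrite ea -[LHS]mulr1 -uv; ring.
  rewrite -eD !inE => -[b Jb [s' /= ey]].
  exists (b * u), (s' * u + s); split; first exact: idealMr.
  by rewrite ea ey; ring.
have Jiter k a : J n a -> exists2 c, J n c & J n.+1 (a - x ^+ k * c).
  move=> Ja; elim: k => [|k [c Jc Jac]].
    by exists a => //; rewrite expr0 mul1r subrr; exact: ideal0.
  have [d Jd Jcd] := Jstep _ Jc; exists d => //.
  have -> : a - x ^+ k.+1 * d = (a - x ^+ k * c) + x ^+ k * (c - x * d).
    by rewrite exprSr; ring.
  by apply: idealD => //; exact: idealMl.
(* Since [J n] lies in [J n.+1 + x ^+ k J n] for every [k], Krull's intersection theorem puts
   [z ^+ n] in [J n.+1]. *)
have [k [t]] : J n.+1 (z ^+ n).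
  apply: (krull_intersection noeth locR (y := x)) => // k.
  have [|c _ Jc] := Jiter k (z ^+ n); last by exists c.
  by exists 0%N, 1; rewrite mul1r mulr1 subrr; exact: ideal0.
have -> : x ^+ k * z ^+ n - z ^+ n.+1 * t = z ^+ n * (x ^+ k - z * t).
  by rewrite exprSr; ring.
case: (prP0) => _ _ /[apply] -[/(prime_idealX prP0)//|P0xz].
apply: nP1x; apply: (prime_idealX prP1 (n := k)).
apply: (@ideal_subr _ _ _ (z * t)) => //; first exact: idealMr.
by case: P01 => /(_ _ P0xz).
Qed.

Let P0_sub_x p : P0 p -> exists r, p = x * r.
Proof.
move=> P0p; apply: contrapT => /residue_unit_power[j [u [v [r [uv ep]]]]].
apply: (@power_notin_principal j (- (r * v)) (p * v)); first exact: idealMr.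
rewrite ep -[LHS]mulr1 -uv; ring.
Qed.

(** If [x] were in [P0], any [z] in [P1] outside [P0] would be a unit times a power of [y] modulo
    [x], so [P1] would contain both [x] and [y]. *)
Let nP0x : ~ P0 x.
Proof.
move=> P0x; have P1x : P1 x by case: P01 => /(_ _ P0x).
case: P01 => _; apply=> z P1z; apply: contrapT => nP0z.
have [|j [u [v [r [uv ez]]]]] := @residue_unit_power z.
  by move=> [r ez]; apply: nP0z; rewrite ez; exact: idealMr.
apply: P1_xy => //; apply: (prime_idealX prP1 (n := j)).
have -> : y ^+ j = z * v - x * (r * v) by rewrite ez -[LHS]mulr1 -uv; ring.
by apply: idealB => //; exact: idealMr.
Qed.

Let P0_eq0 p : P0 p -> p = 0.
Proof.
move=> P0p; apply: (krull_intersection noeth locR (is_ideal_set0 R) mx) => k.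
suff [c P0c ->] : exists2 c, P0 c & p = x ^+ k * c by exists c; rewrite /= subrr.
elim: k => [|k [c P0c ->]]; first by exists p; rewrite // expr0 mul1r.
have [r ec] := P0_sub_x P0c; exists r; last by rewrite ec exprSr mulrA.
by case: (prP0) => _ _ /(_ x r); rewrite -ec => /(_ P0c)[].
Qed.

Lemma parameter_regular t : x * t = 0 -> t = 0.
Proof.
move=> xt0; case: (prP0) => _ _ /(_ x t); rewrite xt0 => /(_ (ideal0 id0)).
by case=> // /P0_eq0.
Qed.

(** Otherwise [b] is a unit times [y ^+ j] modulo [x], and [y ^+ j.+1] would be a multiple of
    [x]. *)
Lemma parameter_regular_mod a b : y * b = x * a -> exists c, b = x * c.
Proof.
move=> yb; apply: contrapT => /residue_unit_power[j [u [v [r [uv eb]]]]].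
apply: (@power_notin_principal j.+1 ((a - y * r) * v) 0); first exact: ideal0.
have -> : x * ((a - y * r) * v) = (x * a - x * y * r) * v by ring.
by rewrite -yb eb exprS addr0 -[LHS]mulr1 -uv; ring.
Qed.

End Chain.
End TwoGenerators.

Lemma regular_local_parameters (R : comNzRingType) (m : set R) :
  regular_local_ring m 2 ->
  exists x y, [/\ m = [set z | exists a b, z = a * x + b * y],
    forall t, x * t = 0 -> t = 0
    & forall a b, y * b = x * a -> exists c, b = x * c].
Proof.
case=> noeth locR [[P [prP ltP]] _] [[|x [|y [|? ?]]] [//= _ mspan]].
have m_xy : m = [set z | exists a b, z = a * x + b * y].
  rewrite mspan predeqE => z; split=> [[c ->]|[a [b ->]]].
    by exists (c 0%N), (c 1%N); rewrite big_ord_recl big_ord1.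
  by exists (fun i => if i == 0%N then a else b); rewrite big_ord_recl big_ord1.
(* The prime [P 2] lies strictly above [P 1] and inside [m]. *)
have P1m : P 1%N <> m.
  move=> eP1; case: (ltP 1%N) => // _; apply; rewrite eP1.
  by have [idP2 P21 _] := prP 2%N isT; exact: (proper_sub_local noeth locR).
have [prP0 prP1] := (prP 0%N isT, prP 1%N isT).
exists x, y; split=> //.
  exact: (parameter_regular noeth locR m_xy prP0 prP1 (ltP 0%N isT) P1m).
exact: (parameter_regular_mod noeth locR m_xy prP0 prP1 (ltP 0%N isT) P1m).
Qed.

(** * Artinian local rings with simple socle *)

Definition simple_socle (A : comNzRingType) (m : set A) :=
  forall u v : A, (forall t, m t -> t * u = 0) -> (forall t, m t -> t * v = 0) ->
    u <> 0 -> exists t, v = t * u.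

Notation annihilator J := (ideal_colon [set 0] J).

(** * Bounds on lengths *)

Section Length.
Variable A : comNzRingType.
Implicit Types (X Y J K L : set A).

(* A filtration of [J / K] with [n] factors, each simple or zero, provides such
   an [l]: it sends an ideal [X] to the number of factors that [X] meets. *)
Definition length_le K J n := exists l : set A -> nat,
  (forall X, (l X <= n)%N) /\
  forall X Y, is_ideal X -> is_ideal Y -> X `<=` Y ->
    (l X <= l Y)%N /\ ((l Y <= l X)%N -> Y `&` K `<=` X -> Y `&` J `<=` X).

Lemma length_le0 K J : J `<=` K -> length_le K J 0.
Proof.
move=> JK; exists (fun=> 0%N); split=> // X Y _ _ _; split=> // _ YKX.
by move=> a [Ya /JK Ka]; exact: YKX.
Qed.

(** Any element of [J] outside [K] generates [J] modulo [K], so it suffices to record whether [X]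
    contains one. *)
Lemma length_le1 K J :
  (forall v w, J v -> J w -> ~ K w -> exists t, K (v - t * w)) ->
  length_le K J 1.
Proof.
move=> KJ.
exists (fun X => `[< exists w, [/\ X w, J w & ~ K w] >] : nat); split=> [X|].
  exact: leq_b1.
move=> X Y idX idY XY; split.
  case: asboolP => // -[w [Xw Jw nKw]].
  suff -> : `[< exists w, [/\ Y w, J w & ~ K w] >] by [].
  by apply/asboolP; exists w; split=> //; exact: XY.
case: asboolP => [_|nY _ YKX v [Yv Jv]]; last first.
  apply: YKX; split=> //; apply: contrapT => nKv; apply: nY.
  by exists v.
case: asboolP => // -[w [Xw Jw nKw]] _ YKX v [Yv Jv].
have [t Kvw] := KJ _ _ Jv Jw nKw.
apply: (ideal_subr (b := t * w)) => //; first exact: idealMl.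
apply: YKX; split=> //; apply: idealB => //; apply: idealMl => //.
exact: XY.
Qed.

(** The counts of the two layers add up; both are monotone, so if the sum does not grow, neither
    count does. *)
Lemma length_leD K J L n p :
  length_le K J n -> length_le J L p -> length_le K L (n + p).
Proof.
move=> [l [lb lmono]] [k [kb kmono]].
exists (fun X => l X + k X)%N; split=> [X|X Y idX idY XY]; first exact: leq_add.
have [[le1 cut1] [le2 cut2]] := (lmono X Y idX idY XY, kmono X Y idX idY XY).
split=> [|le12 /cut1 YJX]; first exact: leq_add.
apply: cut2.
  by rewrite -(leq_add2l (l X)); apply: leq_trans le12; rewrite leq_add2r.
by apply: YJX; rewrite -(leq_add2r (k X)); apply: leq_trans le12; rewrite leq_add2l.
Qed.

Definition strictly_monotone (l : set A -> nat) :=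
  forall X Y, is_ideal X -> is_ideal Y -> X `<` Y -> (l X < l Y)%N.

Lemma length_le_strict K J n : K `<=` [set 0] -> J = setT -> length_le K J n ->
  exists2 l, strictly_monotone l & forall X, (l X <= n)%N.
Proof.
move=> K0 JT [l [lb lmono]]; exists l => // X Y idX idY [XY nYX].
rewrite ltnNge; apply/negP => leYX; apply: nYX.
have [_ /(_ leYX)] := lmono X Y idX idY XY.
rewrite JT setIT; apply=> a [_ /K0 ->].
exact: ideal0.
Qed.

End Length.

(** * Double annihilators and Baer's criterion *)

Section SelfInjective.
Variables (A : comNzRingType) (m : set A).
Hypotheses (noeth : noetherian_ring A) (art : artinian_ring A).
Hypotheses (locA : local_ring m) (socA : simple_socle m).
Implicit Types (J K : set A) (a b : A).

(** Choose [w] in [J] outside [K] with [K + (w)] minimal; if [t * w] were outside [K] for some [t]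
    in [m], then [K + (t * w)] would be strictly smaller, as [1 - r * t] is a unit. *)
Lemma socle_elt K J : is_ideal K -> is_ideal J -> K `<` J ->
  exists w, [/\ J w, ~ K w & forall t, m t -> K (t * w)].
Proof.
move=> idK idJ [KJ nJK].
suff H : forall L, is_ideal L -> forall w, L = adjoin K w -> J w -> ~ K w ->
    exists w, [/\ J w, ~ K w & forall t, m t -> K (t * w)].
  have [w Jw nKw] : exists2 w, J w & ~ K w.
    apply: contrapT => nex; apply: nJK => w Jw.
    by apply: contrapT => nKw; apply: nex; exists w.
  exact: (H _ (is_ideal_adjoin w idK) w).
apply: (artinian_ind art) => L idL IH w eL Jw nKw.
case: (EM (forall t, m t -> K (t * w))) => [Kmw|]; first by exists w.
move=> /existsNP[t /not_implyP[mt nKtw]].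
apply: (IH (adjoin K (t * w)) (is_ideal_adjoin _ idK)) (erefl) _ nKtw; last first.
  exact: idealMl.
split.
  rewrite eL; apply: adjoin_sub; [exact: is_ideal_adjoin|exact: sub_adjoin|].
  by apply: idealMl; [exact: is_ideal_adjoin|exact: mem_adjoin].
move=> /(_ w); rewrite eL => /(_ (mem_adjoin w idK))[k [r [Kk ew]]].
apply: nKw; apply: (local_cancel noeth locA (a := r * t)) => //.
  by apply: idealMl mt; exact: local_ideal locA.
suff -> : (1 - r * t) * w = k by [].
by rewrite mulrBl mul1r {1}ew; ring.
Qed.

(** Here [n] counts the steps of a chain from [K] to [J], each adding a socle element [w] of
    [J / K]. Multiplication by [w] embeds [annihilator K] modulo [annihilator (adjoin K w)] into the
    simple socle of [A], so each step adds at most one to the length. *)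
Lemma annihilator_length J K : is_ideal J -> is_ideal K -> K `<=` J ->
  exists n, length_le (annihilator J) (annihilator K) n /\
    forall l, strictly_monotone l -> (l K + n <= l J)%N.
Proof.
move=> idJ; move: K; apply: (noetherian_ind noeth) => K idK IH KJ.
case: (EM (J `<=` K)) => [JK|nJK].
  have -> : K = J by rewrite eqEsubset.
  exists 0%N; split=> [|l _]; last by rewrite addn0.
  exact: length_le0.
have [w [Jw nKw Kmw]] := socle_elt idK idJ (conj KJ nJK).
have idKw := is_ideal_adjoin w idK.
have [n [len strict]] := IH _ idKw (proper_adjoin idK nKw)
  (adjoin_sub idJ KJ Jw).
exists (n + 1)%N; split=> [|l lmono]; last first.
  rewrite addn1 addnS -addSn; apply: leq_trans (strict l lmono).
  by rewrite leq_add2r; apply: lmono => //; exact: proper_adjoin.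
apply: length_leD len _; apply: length_le1 => u v Ku Kv nKwv.
have vw : v * w <> 0.
  move=> vw; apply: nKwv => _ [k [r [Kk ->]]] /=.
  by rewrite mulrDr (Kv _ Kk) mulrCA vw mulr0 addr0.
have soc a : annihilator K a -> forall t, m t -> t * (a * w) = 0.
  by move=> Ka t mt; rewrite mulrCA; apply: Ka; exact: Kmw.
have [t et] := socA (soc _ Kv) (soc _ Ku) vw.
exists t => _ [k [r [Kk ->]]] /=.
have -> : (u - t * v) * (k + r * w) =
    u * k - t * (v * k) + r * (u * w - t * (v * w)) by ring.
by rewrite (Ku _ Kk) (Kv _ Kk) et subrr !mulr0 subrr addr0.
Qed.

(* Were [J] and [J + (d)] to have the same annihilator, the annihilators of a
   composition series through both would form a shorter one. *)
Lemma double_annihilator J : is_ideal J -> annihilator (annihilator J) `<=` J.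
Proof.
move=> idJ d JJd; apply: contrapT => nJd.
have id0 := is_ideal_set0 A; have idJd := is_ideal_adjoin d idJ.
have J0 : [set 0] `<=` J by move=> _ ->; exact: ideal0.
have [n1 [len1 strict1]] := annihilator_length idJ id0 J0.
have [n2 [len2 strict2]] := annihilator_length (is_idealT A) idJd (@subsetT _ _).
have len0 : length_le (annihilator (adjoin J d)) (annihilator J) 0.
  apply: length_le0 => a Ja _ [k [r [Jk ->]]] /=.
  have da := JJd _ Ja.
  by rewrite mulrDr (Ja _ Jk) mulrCA (mulrC a) da mulr0 addr0.
have annT : annihilator setT `<=` [set 0 : A].
  by move=> a /(_ 1 I); rewrite /= mulr1.
have ann0 : annihilator [set 0] = [set: A].
  by rewrite predeqE => a; split=> // _ _ ->; rewrite /= mulr0.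
have [l lmono lb] :=
  length_le_strict annT ann0 (length_leD len2 (length_leD len0 len1)).
(* The chain from [0] through [J] and [J + (d)] to [A] forces [l setT] to exceed [n1 + n2], the
   bound just obtained. *)
have := lb setT; apply/negP; rewrite -ltnNge add0n addnC.
apply: leq_trans (strict2 _ lmono); rewrite -addSn leq_add2r.
apply: leq_ltn_trans (lmono _ _ idJ idJd (proper_adjoin idJ nJd)).
by apply: leq_trans (strict1 _ lmono); exact: leq_addl.
Qed.

(* [phi] is the graph of a linear map from an ideal to [A]. *)
Lemma baer_criterion (phi : A -> A -> Prop) :
  phi 0 0 ->
  (forall t a b a' b', phi a b -> phi a' b' -> phi (a + t * a') (b + t * b')) ->
  (forall b, phi 0 b -> b = 0) ->
  exists c, forall a b, phi a b -> b = a * c.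
Proof.
move=> phi0 phiD phi_fun.
(* Noetherian induction on an ideal [K] on which [phi] is multiplication by some [c], starting from
   [K = 0]. *)
suff H : forall K, is_ideal K ->
    (exists c, forall a b, K a -> phi a b -> b = a * c) ->
    exists c, forall a b, phi a b -> b = a * c.
  apply: (H [set 0]); first exact: is_ideal_set0.
  by exists 0 => a b ->; rewrite mul0r; exact: phi_fun.
apply: (noetherian_ind noeth) => K idK IH [c Kc].
case: (EM (exists a b, phi a b /\ ~ K a)) => [|nex]; last first.
  exists c => a b ab; apply: Kc (ab); apply: contrapT => nKa.
  by apply: nex; exists a, b.
move=> [a [b [ab nKa]]].
apply: (IH _ (is_ideal_adjoin a idK)); first exact: proper_adjoin.
(* The factor [c] is corrected to [c + e], where [e] must kill [K] and satisfy [e * a = b - a * c];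
   so [b - a * c] has to lie in [E]. *)
pose E : set A := [set z | exists2 e, annihilator K e & z = e * a].
have idE : is_ideal E.
  have [Z0 ZD ZM] := is_ideal_colon K (is_ideal_set0 A).
  split=> [|_ _ [e Ke ->] [f Kf ->]|t _ [e Ke ->]].
  - by exists 0; rewrite ?mul0r.
  - by exists (e + f); [exact: ZD|ring].
  - by exists (t * e); [exact: ZM|ring].
have [e Ke eb] : E (b - a * c).
  (* If [s] kills [E], then [s * a] kills [annihilator K] and so lies in [K], where [phi] is known;
     hence [s] kills [b - a * c]. *)
  apply: double_annihilator => // s Es /=.
  have Ksa : K (s * a).
    apply: double_annihilator => // e Ke /=.
    by rewrite -mulrA (mulrC a); apply: Es; exists e.
  have phis : phi (s * a) (s * b).
    by have := phiD s _ _ _ _ phi0 ab; rewrite !add0r.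
  by rewrite mulrBl mulrC (Kc _ _ Ksa phis); ring.
exists (c + e) => _ b' [k [t [Kk ->]]] ktab.
have phik : phi k (b' - t * b).
  have := phiD (- t) _ _ _ _ ktab ab.
  by have -> : k + t * a + - t * a = k by [ring]; rewrite mulNr.
have -> : b' = (b' - t * b) + t * (b - a * c) + t * a * c by ring.
have ek : e * k = 0 by exact: Ke.
rewrite (Kc _ _ Kk phik) eb.
have -> : (k + t * a) * (c + e) = k * c + t * (e * a) + t * a * c + e * k by ring.
by rewrite ek addr0.
Qed.

End SelfInjective.

(** * Injectivity of [A] from Baer's criterion *)

Section Injectivity.
Variables (A : comNzRingType) (M N : lmodType A).
Variables (f : {linear M -> N}) (g : {linear M -> (A^o : lmodType A)}).
Hypothesis f_inj : injective f.
Hypothesis baer : forall phi : A -> A -> Prop,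
  phi 0 0 ->
  (forall t a b a' b', phi a b -> phi a' b' -> phi (a + t * a') (b + t * b')) ->
  (forall b, phi 0 b -> b = 0) ->
  exists c, forall a b, phi a b -> b = a * c.

Let G0 : set (N * A) := [set p | exists x, p = (f x, g x)].

Let partial_linear (G : set (N * A)) :=
  (forall t p q, G p -> G q -> G (p.1 + t *: q.1, p.2 + t * q.2)) /\
  forall a, G (0, a) -> a = 0.

Let G0_linear : partial_linear G0.
Proof.
split=> [t _ _ [x ->] [y ->]|a [x [fx0 ->]]].
  by exists (x + t *: y); rewrite !linearD !linearZ.
have -> : x = 0 by apply: f_inj; rewrite -fx0 linear0.
by rewrite linear0.
Qed.

(* Adding [G0] on the outside makes the union of the empty chain admissible. *)
Let ext := [set X | partial_linear (X `|` G0)].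

Let max_extension : exists X, ext X /\ forall Y, X `<` Y -> ~ ext Y.
Proof.
apply: Zorn_bigcup => F Fext Ftot.
pose U := \bigcup_(X in F) X `|` G0.
have UP p q : U p -> U q -> exists2 X, partial_linear X & [/\ X `<=` U, X p & X q].
  have FU X : F X -> X `|` G0 `<=` U.
    by move=> FX; apply: setSU; exact: bigcup_sup.
  move=> [[X FX Xp]|G0p] [[Y FY Yq]|G0q].
  - case: (Ftot X Y FX FY) => [XY|YX].
      exists (Y `|` G0); first exact: Fext.
      by split; [exact: FU|left; exact: XY|left].
    exists (X `|` G0); first exact: Fext.
    by split; [exact: FU|left|left; exact: YX].
  - exists (X `|` G0); first exact: Fext.
    by split; [exact: FU|left|right].
  - exists (Y `|` G0); first exact: Fext.
    by split; [exact: FU|right|left].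
  - by exists G0 => //; split=> //; exact: subsetUr.
split=> [t p q Up Uq|a Ua].
  by have [X [Xlin _] [XU Xp Xq]] := UP p q Up Uq; apply: XU; exact: Xlin.
by have [X [_ Xfun] [_ Xa _]] := UP _ _ Ua Ua; exact: Xfun.
Qed.

(** A maximal graph is total: Baer's criterion, applied to the multiples of [n] in its domain,
    yields a value [c] at [n] compatible with the graph. *)
Lemma extend_linear :
  exists h : {linear N -> (A^o : lmodType A)}, forall x, h (f x) = g x.
Proof.
have [X [[Glin Gfun] Xmax]] := max_extension.
set G := X `|` G0 in Glin Gfun.
have G0G : G0 `<=` G by exact: subsetUr.
have G00 : G (0, 0) by apply: G0G; exists 0; rewrite !linear0.
have total n : exists a, G (n, a).
  have [|||c Gc] := @baer (fun a b => G (a *: n, b)).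
  - by rewrite scale0r.
  - move=> t a b a' b' Gab Gab'; have := Glin t _ _ Gab Gab'.
    by rewrite /= scalerA -scalerDl.
  - by move=> b; rewrite scale0r; exact: Gfun.
  pose H : set (N * A) :=
    [set p | exists q t, G q /\ p = (q.1 + t *: n, q.2 + t * c)].
  have GH : G `<=` H.
    by move=> [k a] Gka; exists (k, a), 0; rewrite scale0r mul0r !addr0.
  have extH : ext H.
    rewrite /ext /= (setUidl (subset_trans G0G GH)); split.
      move=> t _ _ [p [r [Gp ->]]] [q [s [Gq ->]]] /=.
      exists (p.1 + t *: q.1, p.2 + t * q.2), (r + t * s).
      split; first exact: Glin.
      rewrite /= !scalerDl !scalerDr scalerA; congr pair; last by ring.
      by rewrite -!addrA; congr (_ + _); rewrite addrCA.
    move=> _ [[k b] [t [Gkb [/esym/eqP + ->]]]] /=.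
    rewrite addrC addr_eq0 => /eqP k0.
    have /= := Gc (- t) b; rewrite scaleNr k0 opprK => /(_ Gkb) ->.
    by ring.
  apply: contrapT => nGn; apply: (Xmax H) => //; split.
    by apply: subset_trans GH; exact: subsetUl.
  move=> HX; apply: nGn; exists c; left; apply: HX.
  by exists (0, 0), 1; rewrite scale1r mul1r !add0r.
have [h Gh] := choice total.
have Guniq n a : G (n, a) -> h n = a.
  move=> Gna; have := Glin (-1) _ _ (Gh n) Gna.
  rewrite /= scaleN1r mulN1r subrr => /Gfun /eqP.
  by rewrite subr_eq0 => /eqP.
have h_lin : linear (h : N -> A^o).
  move=> t u v; apply: Guniq.
  rewrite [X in G (_, X)]addrC [t *: u + v]addrC.
  exact: (Glin t _ _ (Gh v) (Gh u)).
pose hL := GRing.isLinear.Build A N A^o *:%R h h_lin.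
exists (HB.pack_for {linear N -> (A^o : lmodType A)} (h : N -> A^o) hL) => x /=.
by apply: Guniq; apply: G0G; exists x.
Qed.

End Injectivity.

(** Baer's criterion makes [A] injective, so [A] is its own injective resolution, of length zero;
    ['rV[A]_0] serves as the zero module. *)
Lemma simple_socle_gorenstein (A : comNzRingType) (m : set A) :
  noetherian_ring A -> artinian_ring A -> local_ring m -> simple_socle m ->
  gorenstein_ring A.
Proof.
move=> noeth art locA socA.
pose E i : lmodType A := if i is 0%N then (A^o : lmodType A) else 'rV[A]_0.
exists 0%N, E, idfun, (fun i => \0 : {linear E i -> 'rV[A]_0}).
have rV0 (u v : 'rV[A]_0) : u = v by rewrite !thinmx0.
split=> [[|i] M N f g f_inj|//|x|i x|[//|i] _ x].
- apply: extend_linear => // phi.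
  exact: (baer_criterion noeth art locA socA).
- by exists (\0 : {linear N -> 'rV[A]_0}) => x; exact: rV0.
- by split=> _; [exists x|exact: rV0].
- by split=> _; [exists 0|]; exact: rV0.
- exact: rV0.
Qed.

(** * The socle of the quotient *)

(* With [u = x * d] and [v = x * e], an element [a * x + b * y] kills [d] or
   [e] as soon as [a] is in [m], so [d] and [e] have the same annihilator and
   the hypothesis on double annihilators applies to [J = (d)]. *)
Lemma almost_gorenstein_simple_socle (A : comNzRingType) (m : set A) (x y : A) :
  noetherian_ring A -> local_ring m ->
  m = [set z | exists a b, z = a * x + b * y] ->
  (forall J, is_ideal J ->
     annihilator (annihilator J) `<=` ideal_colon J m) ->
  (forall u, x * u = 0 -> y * u = 0 -> exists d, u = x * d /\ y * d = 0) ->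
  simple_socle m.
Proof.
move=> noeth locA m_xy agA soc u v mu mv u0.
have mx : m x by rewrite m_xy; exists 1, 0; ring.
have my : m y by rewrite m_xy; exists 0, 1; ring.
have [d [ud yd]] := soc u (mu _ mx) (mu _ my).
have [e [ve ye]] := soc v (mv _ mx) (mv _ my).
have idd := is_ideal_adjoin d (is_ideal_set0 A).
have kill_d w : w * d = 0 -> w * e = 0.
  move=> wd.
  have mw : m w.
    apply: contrapT => /(local_unit noeth locA)[w' ww']; apply: u0.
    have -> : u = x * w' * (w * d) + (1 - w * w') * u by rewrite ud; ring.
    by rewrite wd ww' subrr mul0r mulr0 addr0.
  have [a [b ew]] : exists a b, w = a * x + b * y by move: mw; rewrite m_xy.
  have au : a * u = 0 by rewrite -[RHS]wd ew ud mulrDl -mulrA -(mulrA b) yd; ring.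
  have ma : m a.
    apply: contrapT => /(local_unit noeth locA)[a' aa']; apply: u0.
    by rewrite -[u]mul1r -aa' (mulrC a) -mulrA au mulr0.
  by rewrite ew mulrDl -(mulrA b) ye mulr0 addr0 -mulrA -ve; exact: mv.
have [_ [t [-> et]]] : adjoin [set 0] d v.
  rewrite ve mulrC; apply: (agA _ idd _ _ _ mx) => w Jw /=.
  rewrite mulrC; apply: kill_d; apply: Jw; exact: mem_adjoin (is_ideal_set0 A).
rewrite add0r in et.
(* If [t] is in [m], its [y] part kills [d], leaving a multiple of [u = x * d]; if [t] is a unit,
   [t * u = x * v = 0] contradicts [u <> 0]. *)
have [mt|/(local_unit noeth locA)[t' tt']] := EM (m t).
  have [a [b eab]] : exists a b, t = a * x + b * y by move: mt; rewrite m_xy.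
  by exists a; rewrite et eab ud mulrDl -(mulrA b) yd; ring.
case: u0; have -> : u = t' * (x * v) + (1 - t * t') * u by rewrite et ud; ring.
by rewrite (mv _ mx) tt' subrr mul0r mulr0 addr0.
Qed.

Lemma ideal_mul_2gen (R : comNzRingType) (x y : R) (I : set R) z : is_ideal I ->
  ideal_mul [set z | exists a b, z = a * x + b * y] I z ->
  exists a b, [/\ I a, I b & z = x * a + y * b].
Proof.
move=> idI [s [sI ->]]; elim: s sI => [|p s IHs] sI.
  by exists 0, 0; rewrite big_nil; split; [exact: ideal0..|ring].
have [a [b [Ia Ib es]]] : exists a b, [/\ I a, I b &
    \sum_(q <- s) q.1 * q.2 = x * a + y * b].
  by apply: IHs => q qs; apply: sI; rewrite inE qs orbT.
have [[c [d ep]] Ip] := sI p (mem_head _ _).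
exists (c * p.2 + a), (d * p.2 + b).
by split; [apply: idealD => //; exact: idealMl..|rewrite big_cons es ep; ring].
Qed.

(** * Transfer of ideals to a quotient ring *)

Section Quotient.
Variables (R A : comNzRingType) (pi : {rmorphism R -> A}).
Hypothesis pi_surj : forall a, exists r, pi r = a.

Lemma is_ideal_preimage (J : set A) : is_ideal J -> is_ideal [set r | J (pi r)].
Proof.
move=> idJ; split=> [|a b|a b] /=; first by rewrite rmorph0; exact: ideal0.
  by rewrite rmorphD; exact: idealD.
by rewrite rmorphM; exact: idealMl.
Qed.

Lemma is_ideal_image (J : set R) : is_ideal J -> is_ideal [set pi r | r in J].
Proof.
move=> idJ; split=> [|_ _ [a Ja <-] [b Jb <-]|t _ [b Jb <-]].
- by exists 0; [exact: ideal0|rewrite rmorph0].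
- by exists (a + b); [exact: idealD|rewrite rmorphD].
- by have [s <-] := pi_surj t; exists (s * b); [exact: idealMl|rewrite rmorphM].
Qed.

Lemma noetherian_quotient : noetherian_ring R -> noetherian_ring A.
Proof.
move=> noeth J idJ; have [s es] := noeth _ (is_ideal_preimage idJ).
exists [seq pi r | r <- s]; rewrite predeqE => a.
have sumE (c : nat -> R) : pi (\sum_(i < size s) c i * s`_i) =
    \sum_(i < size [seq pi r | r <- s]) pi (c i) * [seq pi r | r <- s]`_i.
  rewrite rmorph_sum size_map; apply: eq_bigr => i _.
  by rewrite rmorphM (nth_map 0).
split=> [Ja|[c ->]].
  have [r er] := pi_surj a; have: [set r | J (pi r)] r by rewrite /= er.
  by rewrite es => -[c ec]; exists (pi \o c); rewrite -er ec sumE.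
have [d dc] := choice (fun i => pi_surj (c i)).
have: ideal_span s (\sum_(i < size s) d i * s`_i) by exists d.
by rewrite -es /= sumE; congr J; apply: eq_bigr => i _; rewrite dc.
Qed.

(** The preimage of [mA] is proper, so [mA] lies in the image of [m]; this image is proper because
    the kernel lies in [m], and maximality of [mA] gives equality. *)
Lemma local_quotient (m : set R) (mA : set A) :
  noetherian_ring R -> local_ring m -> local_ring mA ->
  mA = [set pi r | r in m].
Proof.
move=> noeth locR [[idmA mA1 maxA] _].
have [idm m1] := (local_ideal locR, local_neq1 locR).
have ker_m : [set r | pi r = 0] `<=` m.
  apply: (proper_sub_local noeth locR (is_ideal_preimage (is_ideal_set0 A))).
  by rewrite /= rmorph1 => /eqP; rewrite oner_eq0.
case: (maxA [set pi r | r in m]) => [||->//|].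
- exact: is_ideal_image.
- move=> a mAa; have [r er] := pi_surj a; exists r => //.
  apply: (proper_sub_local noeth locR (is_ideal_preimage idmA)) => /=.
    by rewrite rmorph1.
  by rewrite er.
rewrite predeqE => /(_ 1)[_ /(_ I)[r mr er]].
case: m1; apply: (ideal_subr (b := r)) => //; apply: ker_m.
by rewrite /= rmorphB er rmorph1 subrr.
Qed.

End Quotient.

Unset Implicit Arguments.

Theorem proposition6p10 (R : comNzRingType) (m : set R) (I : idealr R)
    (regR : regular_local_ring m 2)
    (artRI : artinian_ring {ideal_quot I})
    (agRI : almost_gorenstein_ring {ideal_quot I})
    (nGorRI : ~ gorenstein_ring {ideal_quot I}) :
  burch_ideal m [set x | x \in I].
Proof.
have [noeth locR _ _] := regR.
pose pi : {rmorphism R -> {ideal_quot I}} := \pi_{ideal_quot I}%qT.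
have pi_surj a : exists r, pi r = a.
  by exists (repr a)%qT; rewrite /pi /= reprK.
have ker_pi r : pi r = 0 <-> r \in I.
  rewrite -[r in r \in I]subr0 Quotient.idealrBE.
  by rewrite -(rmorph0 pi); split=> [->|/eqP].
have idI : is_ideal [set r | r \in I].
  split=> [|a b|a b] /=; [exact: rpred0|exact: rpredD|exact: ring_quotient.idealMr].
split=> // eq_mI; apply: nGorRI.
have [_ [mA [locA agA]]] := agRI.
have noethA := noetherian_quotient pi_surj noeth.
apply: (simple_socle_gorenstein noethA artRI locA).
have [x [y [m_xy regx regy]]] := regular_local_parameters regR.
have mA_xy : mA = [set z | exists a b, z = a * pi x + b * pi y].
  rewrite (local_quotient pi_surj noeth locR locA) m_xy predeqE => z.
  split=> [[_ [a [b ->]] <-]|[a' [b' ->]]].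
    by exists (pi a), (pi b); rewrite rmorphD !rmorphM.
  have [[a <-] [b <-]] := (pi_surj a', pi_surj b').
  by exists (a * x + b * y); [exists a, b|rewrite rmorphD !rmorphM].
apply: (almost_gorenstein_simple_socle noethA locA mA_xy agA) => u' xu yu.
have [u eu] := pi_surj u'; rewrite -eu -!rmorphM !ker_pi in xu yu.
have Imu : ideal_colon [set r | r \in I] m u.
  move=> r; rewrite m_xy => -[a [b ->]] /=.
  have -> : u * (a * x + b * y) = a * (x * u) + b * (y * u) by ring.
  by apply: rpredD; exact: ring_quotient.idealMr.
have : ideal_mul m [set r | r \in I] (y * u).
  rewrite eq_mI; exists [:: (y, u)]; rewrite big_seq1; split=> // p.
  by rewrite inE => /eqP ->; split=> //; rewrite m_xy; exists 0, 1 => /=; ring.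
rewrite m_xy => /(ideal_mul_2gen idI)[a [b [Ia Ib eyu]]].
(* [u - b] has the same class as [u], and [y * (u - b) = x * a]. *)
have [c ec] : exists c, u - b = x * c.
  by apply: (regy a); rewrite mulrBr eyu; ring.
(* Cancelling the regular element [x] leaves [y * c = a], which is in [I]: the class of [c] is the
   required cofactor. *)
have eyc : y * c = a.
  apply/eqP; rewrite -subr_eq0; apply/eqP/regx.
  have -> : x * (y * c - a) = y * (x * c) - x * a by ring.
  by rewrite -ec mulrBr eyu; ring.
exists (pi c); rewrite -!rmorphM; split; last by apply/ker_pi; rewrite eyc.
rewrite -eu -ec rmorphB.
by have -> : pi b = 0 by [apply/ker_pi]; rewrite subr0.
Qed.
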